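(* Let $(X,G,\Phi,\mu)$ be a minimal equicontinuous action of a finitely generated group $G$ on a Cantor set $X$, where $\mu$ is its unique invariant probability measure. Suppose $(X,G,\Phi,\mu)$ is locally non-degenerate. Then the set $X_0$ of points with trivial holonomy has full measure with respect to $\mu$.
   Context: Actions. An action $(X,G,\Phi)$ is a homomorphism $\Phi:G\to \mathrm{Homeo}(X)$, with $g\cdot x=\Phi(g)(x)$. It is minimal if every orbit is dense. It is equicontinuous if $X$ admits a compatible metric $d$ such that for all $\epsilon>0$ there is $\delta>0$ such that $d(x,y)<\delta$ implies $d(g\cdot x,g\cdot y)<\epsilon$ for all $g\in G$. A minimal equicontinuous action is uniquely ergodic, and $\mu$ denotes its unique invariant Borel probability measure. Holonomy. $G_x=\{g\in G\mid g\cdot x=x\}$ and $[G]_x=\{g\in G_x\mid g|V_g=\mathrm{id}\text{ for some open }V_g\ni x\}$. A point $x$ has trivial holonomy if $G_x=[G]_x$; $X_0=\{x\in X\mid G_x=[G]_x\}$. Trees. A rooted spherically homogeneous tree $T$ with spherical index $(n_1,n_2,\ldots)$, where each $n_\ell\ge 2$ is an integer, has vertex set $V=\bigsqcup_{\ell\ge0}V_\ell$ with $|V_0|=1$; every vertex of $V_{\ell-1}$ is joined by edges to exactly $n_\ell$ vertices of $V_\ell$, and every vertex of $V_{\ell}$ is joined to exactly one vertex of $V_{\ell-1}$ ($\ell\ge 1$). The boundary $\partial T$ is the Cantor set of infinite paths $(v_\ell)_{\ell\ge0}$, $v_\ell\in V_\ell$, with consecutive vertices joined by an edge (topology induced from $\prod_\ell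 V_\ell$). For $v\in V$, $\partial T_v\subset\partial T$ is the clopen set of paths through $v$. The counting measure $\mu_{\partial T}$ is the Borel probability measure with $\mu_{\partial T}(\partial T_v)=1/(n_1\cdots n_\ell)$ for $v\in V_\ell$. Every $g\in \mathrm{Aut}(T)$ (root- and level-preserving automorphisms) induces a homeomorphism of $\partial T$. Locally non-degenerate. The action of $g\in \mathrm{Aut}(T)$ on $\partial T$ is locally non-degenerate if there exists $0<\alpha_g\le1$ such that for any vertex $v\in V$, if $g$ fixes $v$ and $g|\partial T_v\neq \mathrm{id}$, then $\mu_{\partial T}(\{\mathbf w\in\partial T_v\mid g\cdot\mathbf w\ne\mathbf w\})\ge \alpha_g\,\mu_{\partial T}(\partial T_v)$. The action of a subgroup of $\mathrm{Aut}(T)$ on $\partial T$ is locally non-degenerate if the action of each of its elements is. A minimal equicontinuous action $(X,G,\Phi,\mu)$ is locally non-degenerate if there exist a rooted spherically homogeneous tree $T$ and a homeomorphism $\phi:X\to\partial T$ such that for every $g\in G$ the map $\phi\circ\Phi(g)\circ\phi^{-1}$ is induced by an automorphism of $T$, and the resulting action of the group $\{\phi\circ\Phi(g)\circ\phi^{-1}\mid g\in G\}$ on $\partial T$ is locally non-degenerate. (Under such $\phi$, $\mu$ is pushed forward to $\mu_{\partial T}$.) *)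

(* Defs.v *)
From HB Require Import structures.
From mathcomp Require Import all_boot all_order all_algebra.
From mathcomp Require Import all_classical all_reals all_analysis.

Set Implicit Arguments.
Unset Strict Implicit.
Unset Printing Implicit Defensive.

Import Order.TTheory GRing.Theory Num.Theory.

Local Open Scope classical_set_scope.
Local Open Scope ring_scope.

Notation borel X := (g_sigma_algebraType (@open X)).

Definition inverse_homeos (X Y : topologicalType) (f : X -> Y) (g : Y -> X) :=
  [/\ cancel f g, cancel g f, continuous f & continuous g].

(* The library's [cantor_like] does not include metrizability, so a Cantor set
   is taken to be a space homeomorphic to [cantor_space], i.e. {0,1}^nat. *)
Definition cantor_set (X : topologicalType) :=
  exists (f : X -> cantor_space) (g : cantor_space -> X), inverse_homeos f g.

Definition finitely_generated (G : groupType) :=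
  exists s : seq G, forall H : {pred G},
    group_closed H -> {subset s <= H} -> forall g, g \in H.

Section Actions.
Variables (X : topologicalType) (G : groupType) (Phi : G -> X -> X).

(* [Phi] is a homomorphism from [G] to the group of homeomorphisms of [X]. *)
Definition action_by_homeos :=
  [/\ forall g, exists f, inverse_homeos (Phi g) f
    & {morph Phi : g h / (g * h)%g >-> g \o h}].

Definition minimal_action := forall x : X, dense (range (fun g => Phi g x)).

Definition metric (R : realType) (d : X -> X -> R) :=
  [/\ forall x y, 0 <= d x y,
      forall x y, d x y = 0 <-> x = y,
      forall x y, d x y = d y x
    & forall x y z, d x z <= d x y + d y z].

Definition compatible_metric (R : realType) (d : X -> X -> R) :=
  metric d /\
  forall (x : X) (A : set X),
    nbhs x A <-> exists2 e : R, 0 < e & [set y | d x y < e] `<=` A.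

Definition equicontinuous_action (R : realType) :=
  exists2 d : X -> X -> R, compatible_metric d &
    forall e : R, 0 < e -> exists2 delta : R, 0 < delta &
      forall x y, d x y < delta -> forall g, d (Phi g x) (Phi g y) < e.

Definition stabilizer (x : X) : set G := [set g | Phi g x = x].

Definition germ_stabilizer (x : X) : set G :=
  [set g | stabilizer x g /\
    exists U : set X, [/\ open U, U x & forall y, U y -> Phi g y = y]].

Definition trivial_holonomy : set X :=
  [set x | stabilizer x = germ_stabilizer x].

End Actions.

(* Uniqueness of the invariant probability measure is not part of this
   definition: it is a consequence of minimality and equicontinuity. *)
Definition invariant_measure (R : realType) (X : ptopologicalType)
    (G : groupType) (Phi : G -> X -> X) (mu : probability (borel X) R) :=
  forall g (A : set (borel X)), measurable A -> mu (Phi g @^-1` A) = mu A.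

(* [tree_adj v w] is the edge relation between consecutive levels;
   [sph_index l] is the number n_(l+1) of children of a vertex of level l. *)
Record sph_tree := SphTree {
  level : nat -> finType;
  tree_adj : forall l, level l -> level l.+1 -> bool;
  sph_index : nat -> nat;
  card_level0 : #|level 0| = 1%N;
  sph_index_ge2 : forall l, (2 <= sph_index l)%N;
  card_children : forall l (v : level l),
    #|[set w | tree_adj v w]%SET| = sph_index l;
  card_parents : forall l (w : level l.+1),
    #|[set v | tree_adj v w]%SET| = 1%N
}.

Section Boundary.
Variable T : sph_tree.

Definition vertex_sequences : Type :=
  prod_topology (fun l => discrete_topology (level T l)).

HB.instance Definition _ := Topological.on vertex_sequences.

Definition is_path : set vertex_sequences :=
  [set p | forall l, tree_adj (p l : level T l) (p l.+1 : level T l.+1)].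

Definition boundary : Type := set_type is_path.

HB.instance Definition _ := Topological.on boundary.

Definition vertex_at (p : boundary) (l : nat) : level T l := set_val p l.

Lemma vertex_at_adj (p : boundary) (l : nat) :
  tree_adj (vertex_at p l) (vertex_at p l.+1).
Proof. exact: (set_mem (valP p)). Qed.

Definition mk_boundary (p : forall l, level T l)
    (pP : forall l, tree_adj (p l) (p l.+1)) : boundary :=
  exist (fun q => q \in is_path) (p : vertex_sequences) (mem_set pP).

Lemma child_exists l (v : level T l) : exists w, tree_adj v w.
Proof.
have /card_gt0P[w] : (0 < #|[set w | tree_adj v w]%SET|)%N.
  by rewrite card_children (leq_trans _ (sph_index_ge2 T l)).
by rewrite inE => vw; exists w.
Qed.

Lemma root_exists : exists v : level T 0, true.
Proof.
have /card_gt0P[v _] : (0 < #|level T 0|)%N by rewrite card_level0.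
by exists v.
Qed.

Fixpoint some_path (l : nat) : level T l :=
  if l is l'.+1 then xchoose (child_exists (some_path l'))
  else xchoose root_exists.

Lemma some_path_adj l : tree_adj (some_path l) (some_path l.+1).
Proof. exact: (xchooseP (child_exists (some_path l))). Qed.

HB.instance Definition _ := isPointed.Build boundary (mk_boundary some_path_adj).

Definition boundary_at l (v : level T l) : set boundary :=
  [set w | vertex_at w l = v].

(* The cylinders generate the topology, so at most one [nu] satisfies this. *)
Definition counting_measure_boundary (R : realType)
    (nu : probability (borel boundary) R) :=
  forall l (v : level T l),
    nu (boundary_at v) = ((\prod_(i < l) sph_index T i)%N%:R^-1 : R)%:E.

Record tree_aut := TreeAut {
  aut_level :> forall l, level T l -> level T l;
  aut_level_bij : forall l, bijective (@aut_level l);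
  aut_level_adj : forall l (v : level T l) (w : level T l.+1),
    tree_adj (@aut_level l v) (@aut_level l.+1 w) = tree_adj v w
}.

Lemma aut_path_adj (a : tree_aut) (p : boundary) l :
  tree_adj (a l (vertex_at p l)) (a l.+1 (vertex_at p l.+1)).
Proof. by rewrite aut_level_adj vertex_at_adj. Qed.

Definition aut_boundary (a : tree_aut) (p : boundary) : boundary :=
  mk_boundary (aut_path_adj a p).

Definition locally_nondegenerate_aut (R : realType)
    (nu : probability (borel boundary) R) (a : tree_aut) :=
  exists2 alpha : R, 0 < alpha <= 1 &
    forall l (v : level T l), a l v = v ->
      ~ (forall w, boundary_at v w -> aut_boundary a w = w) ->
      (alpha%:E * nu (boundary_at v) <=
         nu (boundary_at v `&` [set w | aut_boundary a w <> w]))%E.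

Definition locally_nondegenerate_group (R : realType)
    (nu : probability (borel boundary) R) (H : set tree_aut) :=
  forall a, H a -> locally_nondegenerate_aut nu a.

End Boundary.

Definition locally_nondegenerate_action (R : realType) (X : topologicalType)
    (G : groupType) (Phi : G -> X -> X) :=
  exists (T : sph_tree) (nu : probability (borel (boundary T)) R)
         (phi : X -> boundary T) (psi : boundary T -> X),
    [/\ counting_measure_boundary nu,
        inverse_homeos phi psi,
        forall g, exists a : tree_aut T, phi \o Phi g \o psi = aut_boundary a
      & locally_nondegenerate_group nu
          [set a | exists g, phi \o Phi g \o psi = aut_boundary a]].

(* Main.v *)
(* The points with non-trivial holonomy are those lying, for some g in the
   countable group G, in the set B of fixed points of g which are not interior
   to the fixed-point set.  Transported to the boundary of the tree, the
   complement O of B is open, and a cylinder C of level l not contained in O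
   contains a point of B; by local non-degeneracy the points moved by g, which
   lie in O, fill a proportion at least alpha of C.  If O_l is the union of the
   cylinders of level l contained in O, then
   nu(O) >= nu(O_l) + alpha (1 - nu(O_l)); since nu(O_l) tends to nu(O), this
   forces nu(O) = 1.  Minimality makes G transitive on every level, so mu and
   nu agree on cylinders, hence on open sets. *)
Require Import Defs.
From HB Require Import structures.
From mathcomp Require Import all_boot all_order all_algebra.
From mathcomp Require Import all_classical all_reals all_analysis.
From mathcomp Require Import lra.

Set Implicit Arguments.
Unset Strict Implicit.
Unset Printing Implicit Defensive.

Import Order.TTheory GRing.Theory Num.Theory.
Import numFieldNormedType.Exports.

Local Open Scope classical_set_scope.
Local Open Scope ring_scope.

(** * Countability of finitely generated groups *)

Lemma finitely_generated_countable (G : groupType) : finitely_generated G ->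
  exists f : nat -> G, forall g, exists n, f n = g.
Proof.
move=> [s sG].
(* The flag marks an inverted generator; an index past the end of [s] gives 1, so arbitrary pairs
   are legal letters. *)
pose letter (i : bool * nat) : G :=
  if i.1 then (nth 1%g s i.2)^-1%g else nth 1%g s i.2.
pose eval (w : seq (bool * nat)) : G := (\prod_(i <- w) letter i)%g.
exists (fun n => if unpickle n is Some w then eval w else 1%g) => g.
suff [w <-] : exists w, eval w = g by exists (pickle w); rewrite pickleK.
(* The values of words form a subgroup containing [s], hence all of [G]. *)
suff /asboolP : g \in [pred h : G | `[< exists w, eval w = h >]] by [].
apply: sG => [|h hs].
  split=> [|_ _ /asboolP[u <-] /asboolP[v <-]].
    by apply/asboolP; exists [::]; rewrite /eval big_nil.
  (* A word is inverted by reversing it and flipping its flags. *)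
  apply/asboolP; exists (u ++ rev [seq (~~ i.1, i.2) | i <- v]).
  rewrite /eval big_cat/=; congr (_ * _)%g.
  elim: v => [|i v IHv]; first by rewrite !big_nil invg1.
  rewrite /= rev_cons -cats1 big_cat/= IHv big_seq1 big_cons invgM.
  congr (_ * _)%g.
  by rewrite /letter/=; case: i.1; rewrite //= invgK.
apply/asboolP; exists [:: (false, index h s)].
by rewrite /eval big_seq1 /letter/= nth_index.
Qed.

(** * Cylinders in the boundary of a tree *)

Section Cylinders.
Variable T : sph_tree.
Implicit Types (p q : boundary T) (O : set (boundary T)).

Lemma parent_unique l (u v : level T l) w : tree_adj u w -> tree_adj v w -> u = v.
Proof.
move=> uw vw; have /eqP/cards1P[x /setP xE] := card_parents w.
by move: (xE u) (xE v); rewrite !inE uw vw => /esym/eqP-> /esym/eqP->.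
Qed.

(** Parents are unique, so a vertex of a path determines all the earlier ones. *)
Lemma vertex_at_prefix p q l m : (l <= m)%N ->
  vertex_at p m = vertex_at q m -> vertex_at p l = vertex_at q l.
Proof.
move=> /subnK<-; elim: (m - l)%N => // k IHk; rewrite addSn => pq.
apply/IHk/(@parent_unique _ _ _ (vertex_at p (k + l).+1)); first exact: vertex_at_adj.
by rewrite pq; exact: vertex_at_adj.
Qed.

Lemma open_boundary_at l (v : level T l) : open (boundary_at v).
Proof.
exists [set q : vertex_sequences T | q l = v] => //.
rewrite openE => p pv; rewrite /interior.
have /cvg_sup cvg_l : nbhs p --> p by exact: cvg_id.
apply: (cvg_l l).
exists [set q : vertex_sequences T | q l = v]; split => //.
by exists [set v] => //; exact: discrete_open.
Qed.

Lemma boundary_at_basis O p : open O -> O p ->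
  exists l, boundary_at (vertex_at p l) `<=` O.
Proof.
move=> Oo Op.
(* Convergence of this filter to [p] is checked coordinate by coordinate in the product topology,
   and the cylinder of level [l] already fixes coordinate [l]. *)
pose F := filter_from setT (fun l => boundary_at (vertex_at p l)).
have FF : Filter F.
  apply: filter_from_filter; first by exists 0%N.
  move=> i j _ _; exists (maxn i j) => // q pq.
  by split; apply: vertex_at_prefix pq; rewrite (leq_maxl, leq_maxr).
suff /(_ O) : F --> p.
  by move=> /(_ (open_nbhs_nbhs (conj Oo Op)))[l _ lO]; exists l.
move=> A; rewrite nbhsE/= => -[_ [[U Uo <-] Up] UA].
apply: filterS UA _ => //.
have : set_val @ F --> (set_val p : vertex_sequences T).
  apply/cvg_sup => l B; rewrite nbhsE/= => -[_ [[V Vo <-] Vp] VB].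
  exists l => // q pq; apply: VB => /=.
  by rewrite -[set_val q l]/(vertex_at q l) pq.
by apply; exact: open_nbhs_nbhs.
Qed.

Lemma trivIset_boundary_at l (D : set (level T l)) (A : set (boundary T)) :
  trivIset D (fun v => boundary_at v `&` A).
Proof.
apply/trivIsetP => u v _ _ uv; apply/seteqP; split=> // p [[pu _] [pv _]].
by rewrite -pu -pv eqxx in uv.
Qed.

(** The set O_l of the outline. *)
Definition inner O l : set (boundary T) :=
  \bigcup_(v in [set v : level T l | boundary_at v `<=` O]) boundary_at v.

(** Distinct cylinders of one level are disjoint, so each of them is either part of [inner O l] or
    misses it. *)
Lemma innerE O l (v : level T l) : boundary_at v `&` inner O l =
  if `[< boundary_at v `<=` O >] then boundary_at v else set0.
Proof.
case: asboolP => vO; apply/seteqP; split=> p //=; first by move=> [].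
  by move=> vp; split=> //; exists v.
by move=> [vp [u /= uO up]]; apply: vO; rewrite -vp up.
Qed.

Lemma open_inner O l : open (inner O l).
Proof. by apply: bigcup_open => v _; exact: open_boundary_at. Qed.

Lemma inner_homo O : {homo inner O : l m / (l <= m)%N >-> (l <= m)%O}.
Proof.
move=> l m lm; apply/subsetPset => p [v vO pv]; exists (vertex_at p m) => // q pq.
by apply: vO; rewrite -pv; apply: vertex_at_prefix pq.
Qed.

Lemma bigcup_inner O : open O -> \bigcup_l inner O l = O.
Proof.
move=> Oo; apply/seteqP; split=> [p [l _ [v vO]]|p Op]; first exact: vO.
have [l lO] := boundary_at_basis Oo Op.
by exists l => //; exists (vertex_at p l).
Qed.

End Cylinders.

(** * Measures seen through a continuous map to the boundary, later [phi] or the identity *)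

Section BorelMeasure.
Variables (R : realType) (Y : ptopologicalType).

Lemma open_borel_measurable (A : set (borel Y)) : open (A : set Y) -> measurable A.
Proof. by move=> Ao; apply: sub_sigma_algebra. Qed.

Variables (T : sph_tree) (m : probability (borel Y) R) (f : Y -> boundary T).
Hypothesis fc : continuous f.

Lemma measurable_preimage_open (O : set (boundary T)) : open O ->
  measurable (f @^-1` O : set (borel Y)).
Proof.
by move=> Oo; apply: open_borel_measurable; move/continuousP: fc; apply.
Qed.

Lemma cvg_measure_inner (O : set (boundary T)) : open O ->
  (fun l => m (f @^-1` inner O l)) @ \oo --> m (f @^-1` O).
Proof.
move=> Oo; rewrite -{2}(bigcup_inner Oo) preimage_bigcup.
apply: nondecreasing_cvg_mu.
- by move=> l; apply: measurable_preimage_open; exact: open_inner.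
- apply: bigcup_measurable => l _; apply: measurable_preimage_open; exact: open_inner.
- move=> i j ij; apply/subsetPset => p.
  by have /subsetPset := inner_homo O ij; apply.
Qed.

Lemma measure_cylinders l (D : set (level T l)) (A : set (boundary T)) :
  measurable (f @^-1` A : set (borel Y)) ->
  m (f @^-1` (\bigcup_(v in D) (boundary_at v `&` A))) =
  (\sum_(v \in D) m (f @^-1` (boundary_at v `&` A)))%E.
Proof.
move=> mA; rewrite preimage_bigcup; apply: measure_fin_bigcup.
- exact: finite_finset.
- move=> u v Du Dv [y yuv].
  by apply: (trivIset_boundary_at (A := A) Du Dv); exists (f y).
- move=> v _; rewrite preimage_setI; apply: measurableI => //.
  by apply: measurable_preimage_open; exact: open_boundary_at.
Qed.

End BorelMeasure.

(** * Comparison of measures on cylinders, and the density argument *)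

Section Equidistribution.
Variables (R : realType) (T : sph_tree).

(** The measures agree on each [inner O l], a finite disjoint union of cylinders, and these sets
    increase to [O]. *)
Lemma eq_measure_open (Y Z : ptopologicalType) (m : probability (borel Y) R)
    (n : probability (borel Z) R) (f : Y -> boundary T) (g : Z -> boundary T) :
  continuous f -> continuous g ->
  (forall l (v : level T l),
     m (f @^-1` boundary_at v) = n (g @^-1` boundary_at v)) ->
  forall O, open O -> m (f @^-1` O) = n (g @^-1` O).
Proof.
move=> fc gc mn O Oo.
have := cvg_measure_inner (m := m) fc Oo.
suff -> : (fun l => m (f @^-1` inner O l)) = (fun l => n (g @^-1` inner O l)).
  by move/cvg_unique; apply => //; exact: cvg_measure_inner.
apply/funext => l; rewrite /inner.
under eq_bigcupr do rewrite -[boundary_at _]setIT.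
rewrite (measure_cylinders m fc) ?(measure_cylinders n gc) //.
- by apply: eq_fsbigr => v _; rewrite setIT.
- by apply: measurable_preimage_open => //; exact: openT.
- by apply: measurable_preimage_open => //; exact: openT.
Qed.

(** The cylinders of level [l] partition a total mass of 1, so equal masses must be the inverse of
    the number of vertices, for both measures alike. *)
Lemma transitive_equidistributed (Y Z : ptopologicalType)
    (m : probability (borel Y) R) (n : probability (borel Z) R) (f : Y -> boundary T)
    (g : Z -> boundary T) l :
  continuous f -> continuous g ->
  (forall u v : level T l,
     m (f @^-1` boundary_at u) = m (f @^-1` boundary_at v)) ->
  (forall u v : level T l,
     n (g @^-1` boundary_at u) = n (g @^-1` boundary_at v)) ->
  forall v : level T l, m (f @^-1` boundary_at v) = n (g @^-1` boundary_at v).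
Proof.
move=> fc gc mE nE v.
have key (W : ptopologicalType) (k : probability (borel W) R)
      (h : W -> boundary T) :
    continuous h ->
    (forall u v : level T l,
       k (h @^-1` boundary_at u) = k (h @^-1` boundary_at v)) ->
    k (h @^-1` boundary_at v) = ((#|level T l|%:R)^-1)%:E.
  move=> hc kE.
  have mv : measurable (h @^-1` boundary_at v : set (borel W)).
    by apply: measurable_preimage_open => //; exact: open_boundary_at.
  have := measure_cylinders k hc [set: level T l]
    (measurable_preimage_open hc openT).
  have -> : \bigcup_(v in [set: level T l]) (boundary_at v `&` setT) = setT.
    by apply/seteqP; split=> // p _; exists (vertex_at p l).
  rewrite preimage_setT probability_setT.
  under eq_fsbigr do rewrite setIT (kE _ v).
  rewrite -(fineK (fin_num_measure k _ mv)).
  rewrite (_ : [set: level T l] = [set` predT]); last by apply/seteqP; split.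
  rewrite -(bigfs _ (enum_uniq (level T l))); last first.
    by move=> i _; rewrite mem_enum.
  rewrite sumEFin big_enum/= sumr_const => -[/esym cE].
  congr (_%:E); apply: (@mulIf _ #|level T l|%:R); last first.
    rewrite mulr_natr cE mulVf//.
  1,2: by rewrite pnatr_eq0 -lt0n; apply/card_gt0P; exists v.
by rewrite !key.
Qed.

Variable nu : probability (borel (boundary T)) R.

Lemma fine_measure_cylinders l (A : set (borel (boundary T))) : measurable A ->
  fine (nu A) = \sum_(v : level T l) fine (nu (boundary_at v `&` A)).
Proof.
move=> mA.
have mvA v : measurable (boundary_at v `&` A : set (borel (boundary T))).
  by apply: measurableI => //; apply: open_borel_measurable; exact: open_boundary_at.
rewrite sum_fine => [|v _]; last exact: fin_num_measure.
have /= := measure_cylinders nu (f := id) (fun=> cvg_id) [set: level T l] mA.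
rewrite (_ : _ @^-1` _ = A); last first.
  by apply/seteqP; split=> [p [v _ []]//|p Ap]; exists (vertex_at p l).
rewrite (_ : [set: level T l] = [set` predT]); last by apply/seteqP; split.
rewrite -(bigfs _ (enum_uniq (level T l))); last first.
  by move=> i _; rewrite mem_enum.
by rewrite big_enum => ->.
Qed.

(** In the application [O] consists of the regular points of an automorphism and [M] of the points
    it moves. *)
Lemma full_measure_uniform_density (alpha : R) (O M : set (borel (boundary T))) :
  0 < alpha -> open (O : set (boundary T)) -> measurable M -> M `<=` O ->
  (forall l (v : level T l), ~ boundary_at v `<=` O ->
    (alpha%:E * nu (boundary_at v) <= nu (boundary_at v `&` M))%E) ->
  nu O = 1%E.
Proof.
move=> a0 Oo mM MO dense_M.
have mO : measurable O by exact: open_borel_measurable.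
have mB l (v : level T l) : measurable (boundary_at v : set (borel (boundary T))).
  by apply: open_borel_measurable; exact: open_boundary_at.
have nu_fin (A : set (borel (boundary T))) : measurable A -> nu A \is a fin_num.
  exact: fin_num_measure.
have mI l : measurable (inner O l : set (borel (boundary T))).
  by apply: open_borel_measurable; exact: open_inner.
(* [O] contains [inner O l], and [M] takes up a proportion [alpha] of every
   other cylinder of level [l]. *)
have step l : (1 - alpha) * fine (nu (inner O l)) + alpha <= fine (nu O).
  (* Writing the constant as a multiple of the total mass turns both sides into sums over the
     cylinders of level [l], compared term by term. *)
  have alphaE : alpha = alpha * fine (nu setT) by rewrite probability_setT mulr1.
  rewrite [X in _ + X]alphaE !(@fine_measure_cylinders l)// !mulr_sumr -big_split/=.
  apply: ler_sum => v _; rewrite setIT innerE; case: asboolP => [vO|vO].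
    by rewrite -mulrDl subrK mul1r setIidl.
  rewrite measure0 mulr0 add0r -lee_fin EFinM !fineK ?nu_fin//; last exact: measurableI.
  apply: le_trans (dense_M _ _ vO) _.
  by apply: le_measure; rewrite ?inE; [exact: measurableI..|exact: setIS].
have lim_inner : fine (nu (inner O l)) @[l --> \oo] --> fine (nu O).
  apply: fine_cvg; rewrite fineK ?nu_fin//.
  exact: (@cvg_measure_inner R (boundary T) T nu id (fun=> cvg_id) O Oo).
have lim_step : (1 - alpha) * fine (nu (inner O l)) + alpha @[l --> \oo] -->
    (1 - alpha) * fine (nu O) + alpha.
  by apply: cvgD; [exact: cvgMl_tmp|exact: cvg_cst].
have le_lim : (1 - alpha) * fine (nu O) + alpha <= fine (nu O).
  by apply: (cvgr_to_le lim_step); exact: nearW.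
apply/eqP; rewrite eq_le probability_le1//= -(fineK (nu_fin _ mO)) lee_fin.
(* The limit inequality amounts to alpha <= alpha * nu(O). *)
rewrite -(ler_pM2l a0); move: le_lim; lra.
Qed.

End Equidistribution.

(** * Regular points and trivial holonomy *)

Definition regular_points (Y : topologicalType) (h : Y -> Y) : set Y :=
  [set y | h y <> y] `|` interior [set y | h y = y].

Lemma preimage_regular_points (Y Z : topologicalType) (f : Y -> Z) (g : Z -> Y)
    (h : Y -> Y) :
  inverse_homeos f g -> f @^-1` regular_points (f \o h \o g) = regular_points h.
Proof.
move=> [fK gK fc gc]; apply/seteqP; split=> y [] /=.
- by rewrite fK => hy; left=> hyy; apply: hy; rewrite hyy.
- move=> /fc; rewrite /nbhs/= => near_y; right; apply: filterS near_y => x /=.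
  by rewrite fK => /(can_inj fK).
- by move=> hy; left; rewrite /= fK => /(can_inj fK).
- move=> hy; right; rewrite /interior/=.
  have near_y : nbhs (g (f y)) [set y | h y = y] by rewrite fK.
  have near_gy : nbhs (f y) (g @^-1` [set y | h y = y]) by exact: gc.
  by apply: filterS near_gy => z /= ->; rewrite gK.
Qed.

(** Holonomy is tested one group element at a time, which lets the countability of the group be
    used. *)
Lemma trivial_holonomyE (X : topologicalType) (G : groupType) (Phi : G -> X -> X) :
  trivial_holonomy Phi = \bigcap_g regular_points (Phi g).
Proof.
apply/seteqP; split=> x.
  move=> holx g _; have [gx|] := pselect (Phi g x = x); last by left.
  have : germ_stabilizer Phi x g by rewrite -holx.
  move=> [_ [U [Uo Ux gU]]]; right; rewrite /interior nbhsE.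
  by exists U.
move=> regx; apply/seteqP; split=> g; last by case.
move=> gx; split=> //; have [/(_ gx)//|] := regx g I.
by rewrite /interior nbhsE => -[U [Uo Ux] gU]; exists U.
Qed.

(** * Regular points of a single tree automorphism *)

Section TreeAutomorphisms.
Variables (T : sph_tree) (a : tree_aut T).

Lemma boundary_eqP (p q : boundary T) :
  (forall l, vertex_at p l = vertex_at q l) -> p = q.
Proof. by move=> pq; apply/val_inj/functional_extensionality_dep. Qed.

(** A path is moved as soon as one of its vertices is, so the moved paths form a union of
    cylinders. *)
Lemma open_moved : open [set p | aut_boundary a p <> p].
Proof.
have -> : [set p | aut_boundary a p <> p] =
    \bigcup_l \bigcup_(v in [set v : level T l | a l v <> v]) boundary_at v.
  apply/seteqP; split=> p /=.
    move=> ap; apply: contrapT => np; apply: ap; apply: boundary_eqP => l.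
    by apply: contrapT => apl; apply: np; exists l => //; exists (vertex_at p l).
  by move=> [l _ [v /= av pv]] ap; apply: av; rewrite -pv -[in RHS]ap.
apply: bigcup_open => l _; apply: bigcup_open => v _; exact: open_boundary_at.
Qed.

Lemma open_regular_points : open (regular_points (aut_boundary a)).
Proof. by apply: openU; [exact: open_moved|exact: open_interior]. Qed.

(** If [a] moves [v], it moves every path through [v]; if it acts trivially below [v], the cylinder
    is interior to the fixed-point set. A cylinder not contained in the regular points avoids both
    cases, so local non-degeneracy applies to it. *)
Lemma nondegenerate_regular_points (R : realType)
    (nu : probability (borel (boundary T)) R) :
  locally_nondegenerate_aut nu a -> nu (regular_points (aut_boundary a)) = 1%E.
Proof.
move=> [alpha /andP[alpha0 _] dense_a].
apply: (full_measure_uniform_density alpha0 open_regular_points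
  (M := [set p | aut_boundary a p <> p])).
- by apply: open_borel_measurable; exact: open_moved.
- exact: subsetUl.
move=> l v vO; apply: dense_a.
  apply: contrapT => av; apply: vO => p pv; left => /= ap; apply: av.
  by rewrite -pv -[in RHS]ap.
move=> fix_v; apply: vO => p pv; right.
rewrite /interior nbhsE; exists (boundary_at v) => //.
by split=> //; exact: open_boundary_at.
Qed.

End TreeAutomorphisms.

Theorem theorem1p9 (R : realType) (X : ptopologicalType) (G : groupType)
    (Phi : G -> X -> X) (mu : probability (borel X) R) :
  cantor_set X ->
  finitely_generated G ->
  action_by_homeos Phi ->
  minimal_action Phi ->
  equicontinuous_action Phi R ->
  invariant_measure Phi mu ->
  locally_nondegenerate_action R Phi ->
  measurable (trivial_holonomy Phi : set (borel X)) /\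
  mu (trivial_holonomy Phi) = 1%E.
Proof.
move=> _ /finitely_generated_countable[e e_surj] _ Phi_min _ mu_inv.
move=> [T [nu [phi [psi [nuE phi_homeo aut_ex nondeg]]]]].
have [phiK psiK phic psic] := phi_homeo.
have [a aE] := choice aut_ex.
have aP g x : phi (Phi g x) = aut_boundary (a g) (phi x) by rewrite -aE /= phiK.
have nu_gt0 l (v : level T l) : (0 < nu (boundary_at v))%E.
  rewrite nuE lte_fin invr_gt0 ltr0n; apply: prodn_gt0 => i.
  exact: leq_trans (sph_index_ge2 T i).
have mu_level l (u v : level T l) :
    mu (phi @^-1` boundary_at u) = mu (phi @^-1` boundary_at v).
  (* Positive mass gives a path through each vertex. *)
  have [p pu] : boundary_at u !=set0.
    by apply/set0P/eqP => u0; have := nu_gt0 _ u; rewrite u0 measure0 ltxx.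
  have [q qv] : boundary_at v !=set0.
    by apply/set0P/eqP => v0; have := nu_gt0 _ v; rewrite v0 measure0 ltxx.
  (* By minimality the orbit of [psi p] meets the open set over [v], which yields an element
     carrying [u] to [v]. *)
  have [y [/= yv [g _ gp]]] : (phi @^-1` boundary_at v) `&`
      range (fun g => Phi g (psi p)) !=set0.
    apply: Phi_min; first by exists (psi q) => /=; rewrite psiK.
    by apply: open_comp => [? _|]; [exact: phic|exact: open_boundary_at].
  have agu : a g l u = v by rewrite -pu -yv -gp aP psiK.
  rewrite -(mu_inv g (phi @^-1` boundary_at v)); last first.
    by apply: measurable_preimage_open => //; exact: open_boundary_at.
  (* Injectivity of [a g] on level [l] makes the cylinder over [u] the whole preimage of the one
     over [v]. *)
  congr (mu _); apply/seteqP; split=> x /=; rewrite /boundary_at/= aP -agu.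
    by move=> <-.
  exact: (bij_inj (aut_level_bij (a g) l)).
have mu_cyl l : forall v : level T l,
    mu (phi @^-1` boundary_at v) = nu (id @^-1` boundary_at v).
  apply: transitive_equidistributed => //; first exact: (fun=> cvg_id).
  by move=> u v; rewrite /= !nuE.
have regE g : regular_points (Phi g) = phi @^-1` regular_points (aut_boundary (a g)).
  by rewrite -aE preimage_regular_points.
have reg_meas g : measurable (regular_points (Phi g) : set (borel X)).
  by rewrite regE; apply: measurable_preimage_open => //; exact: open_regular_points.
have reg_full g : mu (regular_points (Phi g)) = 1%E.
  rewrite regE (eq_measure_open phic (fun=> cvg_id) mu_cyl (open_regular_points _)).
  by apply: nondegenerate_regular_points; apply: nondeg; exists g.
(* Indexing by the enumeration [e] makes the intersection countable, as measurability and the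
   null-set argument require. *)
have holE : trivial_holonomy Phi = \bigcap_n regular_points (Phi (e n)).
  rewrite trivial_holonomyE; apply/seteqP; split=> x xreg i _; first exact: xreg.
  by have [n <-] := e_surj i; exact: xreg.
have hol_meas : measurable (trivial_holonomy Phi : set (borel X)).
  by rewrite holE; apply: bigcap_measurableType => n _.
split=> //.
have hol_null : mu (~` trivial_holonomy Phi) = 0%E.
  apply/negligibleP; first exact: measurableC.
  rewrite holE setC_bigcap; apply: negligible_bigcup => n.
  apply/negligibleP; first exact: measurableC.
  by rewrite /= probability_setC// reg_full subee.
rewrite -[trivial_holonomy Phi]setCK probability_setC; last exact: measurableC.
by rewrite hol_null sube0.
Qed.
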